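(* Let $A=\{0,1,2\}$ and let $\varphi\colon A^*\to A^*$ be the primitive substitution given by $\varphi(0)=0001$, $\varphi(1)=02$, $\varphi(2)=001$. Then the language $L$ of $\varphi$ is suffix-connected and contains infinitely many disconnected words.
   Context: $A^*$ is the set of words over $A$, $\varepsilon$ the empty word, $|w|$ the length of $w$. A substitution is a monoid endomorphism of $A^*$. The language $L$ of $\varphi$ is the set of all words that are factors of $\varphi^n(a)$ for some $a\in A$ and $n\in\mathbb{N}$ (the empty word is regarded as an element of $L$). Extension graphs: for $w\in L$ and $k,l\ge 1$, let $\mathbf{L}_k(w)=\{u\in L\cap A^k: uw\in L\}$ and $\mathbf{R}_l(w)=\{v\in L\cap A^l: wv\in L\}$. The extension graph $\mathbf{E}_{k,l}(w)$ is the simple undirected bipartite graph whose vertex set is the disjoint union of (copies of) $\mathbf{L}_k(w)$ and $\mathbf{R}_l(w)$, with an edge between $u\in\mathbf{L}_k(w)$ and $v\in\mathbf{R}_l(w)$ iff $uwv\in L$. Write $\mathbf{L}=\mathbf{L}_1$ and $\mathbf{E}=\mathbf{E}_{1,1}$. A word $w\in L$ is disconnected if the graph $\mathbf{E}(w)$ is not connected. Suffix-connectedness: $\mathrm{tail}(w)$ denotes $w$ with its first letter removed. For $w\in L$ and $1\le d\le |w|+1$, let $p$ be the prefix of $w$ of length $d-1$, so $w=p\,\mathrm{tail}^{d-1}(w)$. The natural embedding of $\mathbf{L}(w)$ in $\mathbf{E}_{d,d}(\mathrm{tail}^{d-1}(w))$ is the map $a\mapsto ap$ from $\mathbf{L}(w)$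 to $\mathbf{L}_d(\mathrm{tail}^{d-1}(w))$. The word $w$ is suffix-connected if for some $1\le d\le|w|+1$ the image of this embedding lies in one connected component of $\mathbf{E}_{d,d}(\mathrm{tail}^{d-1}(w))$. $L$ is suffix-connected if all its non-empty words are suffix-connected. *)

(* Defs.v *)
From mathcomp Require Import all_boot.
From mathcomp Require Import boolp classical_sets functions cardinality.
From Stdlib Require Import Relation_Operators.

Set Implicit Arguments.
Unset Strict Implicit.
Unset Printing Implicit Defensive.

Local Open Scope classical_set_scope.
Local Open Scope nat_scope.

(* The unique monoid endomorphism of A^* with the given images of letters. *)
Definition substitution (A : Type) (f : A -> seq A) (w : seq A) : seq A :=
  flatten [seq f a | a <- w].

Definition primitive (A : finType) (phi : seq A -> seq A) : Prop :=
  exists n, 0 < n /\ forall a b : A, b \in iter n phi [:: a].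

Definition language (A : finType) (phi : seq A -> seq A) : set (seq A) :=
  [set w | exists (a : A) (n : nat), infix w (iter n phi [:: a])].

(* Undirected graphs on a set of vertices: [edge] is expected to be symmetric
   and to relate only vertices. *)
Record graph (V : Type) := Graph {
  vertex : set V;
  edge : V -> V -> Prop
}.

Definition component (V : Type) (G : graph V) (x : V) : set V :=
  [set y | vertex G y /\ clos_refl_trans V (edge G) x y].

Definition connected_graph (V : Type) (G : graph V) : Prop :=
  forall x y, vertex G x -> vertex G y -> component G x y.

Definition left_ext (A : Type) (L : set (seq A)) (k : nat) (w : seq A)
    : set (seq A) :=
  [set u | [/\ L u, size u = k & L (u ++ w)]].

Definition right_ext (A : Type) (L : set (seq A)) (l : nat) (w : seq A)
    : set (seq A) :=
  [set v | [/\ L v, size v = l & L (w ++ v)]].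

Definition ext_vertex (A : Type) (L : set (seq A)) (k l : nat) (w : seq A)
    : set (seq A + seq A) :=
  [set x | match x with
           | inl u => left_ext L k w u
           | inr v => right_ext L l w v
           end].

Definition ext_edge (A : Type) (L : set (seq A)) (k l : nat) (w : seq A)
    (x y : seq A + seq A) : Prop :=
  match x, y with
  | inl u, inr v | inr v, inl u =>
      [/\ left_ext L k w u, right_ext L l w v & L (u ++ w ++ v)]
  | _, _ => False
  end.

Definition ext_graph (A : Type) (L : set (seq A)) (k l : nat) (w : seq A)
    : graph (seq A + seq A) :=
  Graph (ext_vertex L k l w) (ext_edge L k l w).

Definition disconnected (A : Type) (L : set (seq A)) (w : seq A) : Prop :=
  L w /\ ~ connected_graph (ext_graph L 1 1 w).

(* Elements of L(w) are one-letter words [a], and [a ++ take d.-1 w] is the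
   image of [a] under the natural embedding. *)
Definition suffix_connected_word (A : Type) (L : set (seq A)) (w : seq A)
    : Prop :=
  exists d, 1 <= d <= (size w).+1 /\
    let G := ext_graph L d d (iter d.-1 behead w) in
    exists x, vertex G x /\
      forall a, left_ext L 1 w a -> component G x (inl (a ++ take d.-1 w)).

Definition suffix_connected (A : Type) (L : set (seq A)) : Prop :=
  forall w, L w -> w <> [::] -> suffix_connected_word L w.

Definition l0 : 'I_3 := @Ordinal 3 0 isT.
Definition l1 : 'I_3 := @Ordinal 3 1 isT.
Definition l2 : 'I_3 := @Ordinal 3 2 isT.

Definition phi : seq 'I_3 -> seq 'I_3 :=
  substitution (fun a : 'I_3 =>
    nth [::] [:: [:: l0; l0; l0; l1]; [:: l0; l2]; [:: l0; l0; l1]] a).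

(* Main.v *)
Require Import Defs.
From mathcomp Require Import all_boot.
From mathcomp Require Import boolp classical_sets functions cardinality.
From mathcomp Require Import zify.
From Stdlib Require Import Relation_Operators.

Set Implicit Arguments.
Unset Strict Implicit.
Unset Printing Implicit Defensive.

Local Notation letter := 'I_3.
Local Notation word := (seq 'I_3).
Local Notation L := (language phi).

(** Every word of the language that contains a non-zero letter can be read back
    through [phi], because [l1] and [l2] occur only at the ends of the blocks
    [phi [:: a]]. For a word [w] with several left and several right extensions,
    this shows that [w] is [s ++ phi y ++ nseq k l0] with [s] empty or equal to
    [001], with [k = 1] or [k = 2], and with [y] a shorter word of the language
    ([bispecial_shape]). Moreover the edges of the extension graph of [w] are
    exactly the images of edges of the extension graph of [y] under two partial
    maps of letters, one for each side ([edge_child]). So all extension graphs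
    are found by following the words [w] that descend from [0] and [00] and from
    the empty word.

    On the right, both maps send [l0] to [l0]. If [l0] is adjacent to all left
    extensions of [y], this is also true for the children of [y]. The empty word
    and [0] have this property but [00] does not, since [0000] is not in the
    language. Among the children of [00], one is disconnected,
    [w0 = 001 phi(00) 0], whose graph consists of the edges [0 -- 2] and
    [1 -- 0]. From then on each disconnected word [w] has a single child with
    several extensions on both sides: it is [phi w 0] or [phi w 00], in
    alternation, and its graph again consists of two disjoint edges
    ([split_word_step]). This gives infinitely many disconnected words, and
    [classification] says that there are no others.

    It remains to connect the two left extensions [x] and [x'] of a disconnected
    word [w] by looking at longer extensions of a suffix of [w]. For [w0 = p t]
    with [p = 001] there is a path [x p -- v -- u -- v' -- x' p] around [t], with
    [u] and [v'] equal to [00102] and [v] to [20001]. The image of such a path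
    under [phi] is a path for the child of [w], provided that [u], [v] and [v']
    remain longer than [p]. This is the case because they contain at least as
    many occurrences of each letter as [0 p] does, a property that [phi]
    preserves up to a surplus that pays for the zeros moved from [v] and [v']
    into the child ([ample_phi]). *)

(** * The substitution *)

Lemma letter_ind (P : letter -> Prop) : P l0 -> P l1 -> P l2 -> forall a, P a.
Proof.
move=> P0 P1 P2 [[|[|[|//]]] lt_a].
- by rewrite (_ : Ordinal lt_a = l0) //; apply: val_inj.
- by rewrite (_ : Ordinal lt_a = l1) //; apply: val_inj.
- by rewrite (_ : Ordinal lt_a = l2) //; apply: val_inj.
Qed.

Lemma phi_cat x y : phi (x ++ y) = phi x ++ phi y.
Proof. by rewrite /phi /substitution map_cat flatten_cat. Qed.

Lemma phi_cons a x : phi (a :: x) = phi [:: a] ++ phi x.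
Proof. exact: (phi_cat [:: a]). Qed.

Lemma phi_rcons x a : phi (rcons x a) = phi x ++ phi [:: a].
Proof. by rewrite -cats1 phi_cat. Qed.

Lemma phi_letter x : (phi (l0 :: x) = [:: l0, l0, l0, l1 & phi x]) *
  (phi (l1 :: x) = [:: l0, l2 & phi x]) *
  (phi (l2 :: x) = [:: l0, l0, l1 & phi x]) * (phi [::] = [::]).
Proof. by []. Qed.

Lemma size_phi x : size x <= size (phi x).
Proof.
elim: x => // a x IHx; rewrite phi_cons size_cat /=.
by elim/letter_ind: a => /=; lia.
Qed.

Lemma infix_phi x y : infix x y -> infix (phi x) (phi y).
Proof. by case/infixP=> p [q ->]; rewrite !phi_cat infix_infix. Qed.

Lemma primitive_phi : primitive phi.
Proof. by exists 3; split=> // a b; elim/letter_ind: a; elim/letter_ind: b. Qed.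

(** Every image of a letter is a power of [l0] followed by a single non-zero
    letter, so non-zero letters mark the ends of the blocks. *)
Lemma phi_cut x p c q : phi x = p ++ c :: q -> c != l0 ->
  exists x1 x2, [/\ x = x1 ++ x2, phi x1 = rcons p c & phi x2 = q].
Proof.
move=> + c_neq0; elim: x p => [|a x IHx] p; first by case: p.
have inside p' : phi (a :: x) = phi [:: a] ++ p' ++ c :: q ->
    p = phi [:: a] ++ p' ->
  exists x1 x2, [/\ a :: x = x1 ++ x2, phi x1 = rcons p c & phi x2 = q].
  rewrite phi_cons => /eqP; rewrite eqseq_cat // => /andP[_ /eqP/IHx].
  case=> x1 [x2 [-> px1 px2]] ->; exists (a :: x1), x2.
  by rewrite phi_cons px1 rcons_cat.
move=> def_phi; move: (def_phi) inside.
elim/letter_ind: a {def_phi} => /=; rewrite !phi_letter.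
- case: p => [|? [|? [|? [|? p]]]] /= [].
  + by move=> e; case/eqP: c_neq0.
  + by move=> _ e; case/eqP: c_neq0.
  + by move=> _ _ e; case/eqP: c_neq0.
  + by move=> <- <- <- <- px _; exists [:: l0], x.
  + by move=> <- <- <- <- px; apply; rewrite ?px //.
- case: p => [|? [|? p]] /= [].
  + by move=> e; case/eqP: c_neq0.
  + by move=> <- <- px _; exists [:: l1], x.
  + by move=> <- <- px; apply; rewrite ?px.
- case: p => [|? [|? [|? p]]] /= [].
  + by move=> e; case/eqP: c_neq0.
  + by move=> _ e; case/eqP: c_neq0.
  + by move=> <- <- <- px _; exists [:: l2], x.
  + by move=> <- <- <- px; apply; rewrite ?px.
Qed.

(** The three blocks form a prefix code. *)
Lemma phi_prefix x y q :
  phi x = phi y ++ q -> exists2 z, x = y ++ z & phi z = q.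
Proof.
elim: y x => [|b y IHy] [|a x] /=.
- by exists [::].
- by exists (a :: x).
- by elim/letter_ind: b.
by elim/letter_ind: a; elim/letter_ind: b;
  rewrite !phi_letter // => -[]// /IHy[z -> <-]; exists z.
Qed.

(** * The language *)

Lemma language_factor u w : L w -> infix u w -> L u.
Proof. by case=> a [n w_in] u_in; exists a, n; apply: infix_trans w_in. Qed.

Lemma iter_phi_infix n x y :
  infix x y -> infix (iter n phi x) (iter n phi y).
Proof. by move=> xy; elim: n => //= n; apply: infix_phi. Qed.

Lemma iter_phi_cat n x y : iter n phi (x ++ y) = iter n phi x ++ iter n phi y.
Proof. by elim: n => //= n ->; rewrite phi_cat. Qed.

Lemma language0P w : L w <-> exists n, infix w (iter n phi [:: l0]).
Proof.
split=> [[a [n w_in]]|[n]]; last by exists l0, n.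
exists (n + 2); apply: infix_trans w_in _; rewrite iterD; apply: iter_phi_infix.
by elim/letter_ind: a.
Qed.

(* Among the three copies of [iter n phi [:: l0]] at the beginning of
   [iter n.+1 phi [:: l0]], the middle one is preceded and followed by
   letters. *)
Lemma language_extend w : L w -> exists a b, L (a :: rcons w b).
Proof.
case/language0P=> n /infixP[p [q def_w]].
set x := iter n phi [:: l0] in def_w.
have [a [x' def_x]] : exists a x', x = a :: x'.
  by rewrite /x; elim: n {x def_w} => [|n [a [x' /= ->]]]; [exists l0, [::] |
    elim/letter_ind: a; do 2!eexists].
have Lx : L (x ++ x ++ x).
  apply/language0P; exists n.+1; apply/infixP; exists [::].
  exists (iter n phi [:: l1]).
  by rewrite iterSr -!catA /x -!iter_phi_cat.
have [z [c def_pz]] : exists z c, x ++ p = rcons z c.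
  by exists (belast a (x' ++ p)), (last a (x' ++ p)); rewrite -lastI def_x.
have [d [z' def_qz]] : exists d z', q ++ x = d :: z'.
  by case: (q) => [|d q']; [exists a, x' | exists d, (q' ++ x)].
exists c, d; apply: language_factor Lx _; apply/infixP; exists z, z'.
by rewrite {2}def_w -cats1 !cat_cons /= -!catA /= -def_qz
  -[z ++ c :: _]cat_rcons -def_pz -!catA.
Qed.

Lemma language_phi w : L w -> L (phi w).
Proof. by case=> a [n /infix_phi w_in]; exists a, n.+1. Qed.

Lemma language_desubst u : L u -> exists2 x, L x & infix u (phi x).
Proof.
case/language0P=> -[|n] u_in; last first.
  by exists (iter n phi [:: l0]) => //; exists l0, n; apply: infix_refl.
exists [:: l0]; first by exists l0, 0.
by apply: (infix_trans u_in).
Qed.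

Lemma infix_phi_short u x : infix u (phi x) -> size u <= 4 ->
  exists y, [/\ infix y x, size y <= 4 & infix u (phi y)].
Proof.
move=> + u_le4; elim: x => [|a x IHx] u_in; first by exists [::].
have [ltx|gtx] := leqP (size (a :: x)) 4.
  by exists (a :: x); rewrite infix_refl.
case/infixP: u_in => p [q]; rewrite phi_cons.
have [ltp|gep] := ltnP (size p) (size (phi [:: a])) => def_phi.
  exists (a :: take 3 x); split.
  - by apply: prefixW; rewrite /= eqxx prefix_take.
  - by rewrite /= size_take_min ltnS geq_minl.
  have le_take : 4 <= size (phi (take 3 x)).
    case: x gtx {IHx def_phi} => [|b [|c [|d x]]] //= _.
    by elim/letter_ind: b; elim/letter_ind: c; elim/letter_ind: d.
  have pu_pre : prefix (p ++ u) (phi (a :: take 3 x)).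
    rewrite phi_cons.
    have -> : p ++ u = take (size (p ++ u)) (phi [:: a] ++ phi x).
      by rewrite def_phi catA take_size_cat.
    rewrite -{1}[x](cat_take_drop 3) phi_cat catA takel_cat ?prefix_take //.
    by rewrite (size_cat p) (size_cat (phi [:: a])); lia.
  case/prefixP: pu_pre => s ->; rewrite -catA; exact: infix_infix.
move/eqP: def_phi; rewrite -[p](cat_take_drop (size (phi [:: a]))) -catA.
rewrite eqseq_cat; last by rewrite size_take_min (minn_idPl gep).
case/andP=> _ /eqP phx; case: IHx => [|y [yx y4 uy]].
  by rewrite phx infix_infix.
by exists y; split=> //; apply: infix_trans yx (infix_cons _ _).
Qed.

(** The finite word that shows all the factors of length at most 4: one more
    application of [phi] produces no new ones. *)
Lemma language_short u : L u -> size u <= 4 ->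
  infix u (iter 3 phi [:: l0]).
Proof.
case/language0P=> n; elim: n u => [|n IHn] u u_in u_le4.
  by apply: (infix_trans u_in); vm_compute.
case: (infix_phi_short u_in u_le4) => y [/IHn y_in /y_in{}y_in uy].
case/infixP: (infix_trans uy (infix_phi y_in)) => p [q def_phi].
have/allP all_ok : all (fun i => all (fun k =>
    infix (take k (drop i (phi (iter 3 phi [:: l0])))) (iter 3 phi [:: l0]))
    (iota 0 5)) (iota 0 (size (phi (iter 3 phi [:: l0]))).+1) by vm_compute.
rewrite def_phi {def_phi} in all_ok.
have p_le : size p \in iota 0 (size (p ++ u ++ q)).+1.
  by rewrite mem_iota add0n ltnS size_cat leq_addr.
have := allP (all_ok _ p_le) (size u).
by rewrite drop_size_cat // take_size_cat //; apply; rewrite mem_iota.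
Qed.

(** * Extensions of a word and of its image *)

Lemma language_iter w n : infix w (iter n phi [:: l0]) -> L w.
Proof. by exists l0, n. Qed.

Lemma forbidden u w : L w -> infix u w -> size u <= 4 ->
  infix u (iter 3 phi [:: l0]).
Proof. by move=> Lw /(language_factor Lw); apply: language_short. Qed.

Definition edge (w : word) (a b : letter) : Prop := L (a :: w ++ [:: b]).

Lemma edge_right w a : L (a :: w) -> exists b, edge w a b.
Proof.
case/language_extend=> z [b Lw]; exists b; apply: language_factor Lw _.
by rewrite rcons_cons -cats1 infix_cons.
Qed.

Lemma edge_ex w : L w -> exists a b, edge w a b.
Proof.
by case/language_extend=> a [b Lw]; exists a, b; rewrite /edge cats1.
Qed.

Lemma edgeL w a b : edge w a b -> L (a :: w).
Proof. by move/language_factor; apply; rewrite -cat_cons prefix_infix. Qed.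

Lemma edge_mid w a b : edge w a b -> L w.
Proof.
by move/edgeL/language_factor; apply; apply: infix_cons.
Qed.

Lemma before_l2 z x : L (z :: l2 :: x) -> z = l0.
Proof.
move=> Lz; have := @forbidden [:: z; l2] _ Lz (prefix_infix [:: z; l2] x) isT.
by elim/letter_ind: z {Lz}; vm_compute.
Qed.

Definition right_step (k : nat) (b e : letter) : bool :=
  prefix (rcons (nseq k l0) e) (phi [:: b]).

(** The block of [l2] is as short as [s] can be, so that the letter [c] before
    [s] may belong to the previous block. This is the block of [l0], because
    [l2] always follows [l0]; before other letters, [l0] is immaterial. *)
Definition left_step (s : word) (a c : letter) : bool :=
  suffix (c :: s) (phi [:: l0; a]).

Definition child (s : word) (k : nat) (y : word) : word :=
  s ++ phi y ++ nseq k l0.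

(** The pairs [(s, y)] such that every occurrence of [s ++ phi y] in the image
    of a word comes from an occurrence of [y]. *)
Variant synchronized : word -> word -> Prop :=
  | SyncEmpty y : synchronized [::] (l0 :: y)
  | SyncSuffix y : synchronized [:: l0; l0; l1] y.

Lemma phi_ends s y z a c : synchronized s y -> (a = l2 -> z = l0) ->
  left_step s a c -> suffix (c :: s) (phi [:: z; a]).
Proof.
case=> {s y} _; elim/letter_ind: a => z0; try (move: (z0 erefl) => ->);
  by elim/letter_ind: c; elim/letter_ind: z {z0}; vm_compute.
Qed.

(** A word [child s k y] carries the markers that let one read off [y]. So its
    occurrences in a word of the language come from occurrences of [y], and its
    extensions are the images of the extensions of [y]. *)
Lemma edge_child s y k c e : synchronized s y -> 0 < k <= 2 ->
  edge (child s k y) c e <->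
  exists a b, [/\ edge y a b, left_step s a c & right_step k b e].
Proof.
move=> sync_sy k12; split=> [Lw|[a [b [Lw sa]]]]; last first.
  case/prefixP=> r def_b; case/language_extend: (Lw) => z [z' Lz].
  have{z' Lz} Lz : L (z :: a :: y ++ [:: b]).
    by apply: language_factor Lz _; rewrite -rcons_cons -cats1 prefix_infix.
  have z_a : a = l2 -> z = l0.
    by move=> a2; move: Lz; rewrite a2; apply: before_l2.
  case/suffixP: (phi_ends sync_sy z_a sa) => q def_za.
  apply: language_factor (language_phi Lz) _; apply/infixP; exists q, r.
  rewrite -[z :: _]/([:: z; a] ++ _) phi_cat def_za phi_cat def_b /child.
  by rewrite -cats1 -!catA /= -!catA.
have [x Lx /infixP[p [q]]] := language_desubst Lw.
have right_end x3 : phi x3 = nseq k l0 ++ e :: q ->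
    exists b x4, x3 = b :: x4 /\ right_step k b e.
  case: k k12 {Lw} => [|[|[|//]]] // _.
    by case: x3 => // b x4; elim/letter_ind: b; rewrite phi_letter => -[<- _];
      (eexists; eexists; split; first reflexivity).
  by case: x3 => // b x4; elim/letter_ind: b; rewrite phi_letter => // -[<- _];
      (eexists; eexists; split; first reflexivity).
rewrite /child -!catA cat_cons -!catA /=.
have finish x0 a x2 : x = rcons x0 a ++ x2 ->
   phi x2 = phi y ++ nseq k l0 ++ e :: q -> left_step s a c ->
   exists a b, [/\ edge y a b, left_step s a c & right_step k b e].
  move=> def_x /phi_prefix[x3 def_x2 /right_end[b [x4 [def_x3 rb]]]] sa.
  exists a, b; split=> //; apply: language_factor Lx _; apply/infixP.
  by exists x0, x4; rewrite def_x def_x2 def_x3 -cats1 -!catA /= -catA.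
case: sync_sy Lw finish => {s y} y Lw finish.
  have c_neq0 : c != l0.
    apply: contraTneq isT => c0; move: Lw; rewrite c0 => Lw.
    by have := @forbidden (nseq 4 l0) _ Lw (prefix_infix _ _) isT; vm_compute.
  case/phi_cut=> // x1 [x2 [def_x px1 px2]].
  case/lastP: x1 => [|x0 a] in def_x px1; first by case: (p) px1.
  apply: (finish _ _ _ def_x) => //.
  move/(congr1 (last l0)): px1; rewrite phi_rcons last_cat last_rcons => <-.
  by elim/letter_ind: a def_x.
rewrite -[c :: _]/([:: c; l0; l0] ++ l1 :: _) catA.
case/phi_cut=> // x1 [x2 [def_x px1 px2]].
case/lastP: x1 => [|x0 a] in def_x px1.
  by move/(congr1 size): px1; rewrite size_rcons.
apply: (finish _ _ _ def_x) => //.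
move/(congr1 rev): px1; rewrite phi_rcons rev_rcons !rev_cat.
rewrite -[rev [:: c; _; _]]/[:: l0; l0; c].
elim/letter_ind: a def_x => def_x; move=> /=.
- by case=> <-.
- by [].
case/lastP: x0 def_x => [|x0 z] def_x; first by [].
have -> : z = l0.
  apply: (@before_l2 _ x2); apply: language_factor Lx _.
  by rewrite def_x -!cats1 -!catA; apply: suffixW; apply: suffix_suffix.
by rewrite phi_rcons rev_cat => -[<-].
Qed.

(** * Desubstitution of bispecial words *)

Definition left_unique (w : word) : Prop :=
  exists a0, forall a b, edge w a b -> a = a0.

Definition right_unique (w : word) : Prop :=
  exists b0, forall a b, edge w a b -> b = b0.

Lemma edge_prefix u v a b : edge (u ++ v) a b -> size u < 4 ->
  infix (a :: u) (iter 3 phi [:: l0]).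
Proof.
move=> Lw u_lt4; apply: forbidden Lw _ _ => //.
by rewrite -catA -cat_cons prefix_infix.
Qed.

Lemma edge_suffix u v a b : edge (v ++ u) a b -> size u < 4 ->
  infix (rcons u b) (iter 3 phi [:: l0]).
Proof.
move=> Lw u_lt4; apply: forbidden Lw _ _; last by rewrite size_rcons.
by rewrite -catA -cats1; apply: suffixW; rewrite -cat_cons suffix_suffix.
Qed.

Lemma edge_short w a b : size w <= 2 ->
  edge w a b <-> infix (a :: w ++ [:: b]) (iter 3 phi [:: l0]).
Proof.
move=> w2; split=> [Lw|]; last exact: language_iter.
by apply: language_short => //=; rewrite size_cat /=; lia.
Qed.

Lemma leading_zeros (w : word) : w = nseq (size w) l0 \/
  exists i c z, c != l0 /\ w = nseq i l0 ++ c :: z.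
Proof.
elim: w => [|a w IHw]; first by left.
have [->|a_neq0] := eqVneq a l0; last by right; exists 0, a, w.
case: IHw => [{1}->|[i [c [z [c_neq0 ->]]]]]; first by left.
by right; exists i.+1, c, z.
Qed.

Lemma trailing_zeros (w : word) :
  exists g k, last l1 g != l0 /\ w = g ++ nseq k l0.
Proof.
elim/last_ind: w => [|w a [g [k [g_neq0 def_w]]]]; first by exists [::], 0.
have [->|a_neq0] := eqVneq a l0.
  by exists g, k.+1; rewrite def_w -cats1 -catA -(addn1 k) nseqD.
by exists (rcons w a), 0; rewrite last_rcons cats0.
Qed.

(** If [w] contains a non-zero letter, write it as [0^i c (phi y) 0^k] with [c]
    non-zero. The letter before [0^i c] is forced unless [0^i c] is [001] or the
    whole block [0001]; the letter after [0^k] is forced unless [k] is 1 or 2. *)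
Lemma bispecial_shape w : L w ->
  [\/ left_unique w, right_unique w, w \in [:: [::]; [:: l0]; [:: l0; l0]]
    | exists s y k, [/\ synchronized s y, 0 < k <= 2 & w = child s k y]].
Proof.
move=> Lw.
have many_zeros v k : 2 < k -> w = v ++ nseq k l0 -> right_unique w.
  move=> k3 def_w; exists l1 => a b; rewrite def_w -(subnK k3) nseqD catA.
  by move/edge_suffix=> /(_ isT); elim/letter_ind: b; vm_compute.
have [def_w|[i [c [z [c_neq0 def_w]]]]] := leading_zeros w.
  have [w3|] := ltnP 2 (size w).
    by apply: Or42; apply: (many_zeros [::]) w3 _.
  by move: def_w; case: (size w) => [|[|[|//]]] -> _; apply: Or43.
have [g [k [g_neq0 def_z]]] := trailing_zeros z.
have [x _ /infixP[p [q def_phi]]] := language_desubst Lw.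
rewrite def_w -catA cat_cons def_z -catA catA in def_phi.
case/phi_cut: def_phi=> // _ [x2 [_ _ px2]].
have{x2 px2} [y def_g] : exists y, g = phi y.
  case/lastP: g g_neq0 {def_z} px2 => [|g d]; first by exists [::].
  rewrite last_rcons cat_rcons => d_neq0 /phi_cut[] // y [_ [_ <- _]].
  by exists y.
rewrite def_z -cat_cons catA in def_w.
have [k0|k_gt0] := posnP k.
  apply: Or42; exists l0 => a b.
  have -> : w = rcons (nseq i l0 ++ belast c g) (last c g).
    by rewrite def_w k0 cats0 rcons_cat -lastI.
  rewrite -cats1 => /edge_suffix => /(_ isT).
  have : last c g != l0 by case: (g) g_neq0.
  by elim/letter_ind: (last c g); elim/letter_ind: b; vm_compute.
have [k3|k_le2] := ltnP 2 k; first by apply: Or42; apply: many_zeros k3 def_w.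
have [a [b Lawb]] := edge_ex Lw.
case: i def_w => [|[|[|[|i]]]] def_w.
- apply: Or41; exists l0 => a' b'; rewrite def_w -[_ ++ _]/([:: c] ++ _).
  move/edge_prefix => /(_ isT).
  by elim/letter_ind: c c_neq0 {def_w} => //; elim/letter_ind: a'; vm_compute.
- apply: Or41; exists (if c == l1 then l0 else l1) => a' b'.
  rewrite def_w -[_ ++ _]/([:: l0; c] ++ _).
  move/edge_prefix => /(_ isT).
  by elim/letter_ind: c c_neq0 {def_w} => //; elim/letter_ind: a'; vm_compute.
- apply: Or44; exists [:: l0; l0; l1], y, k; split; rewrite ?k_gt0 //.
    exact: SyncSuffix.
  suff -> : l1 = c by rewrite def_w def_g.
  move: Lawb; rewrite def_w -[_ ++ _]/([:: l0; l0; c] ++ _).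
  move/edge_prefix => /(_ isT).
  by elim/letter_ind: c c_neq0 {def_w} => //; elim/letter_ind: a; vm_compute.
- apply: Or44; exists [::], (l0 :: y), k; split; rewrite ?k_gt0 //.
    exact: SyncEmpty.
  have : infix [:: l0; l0; c] (iter 3 phi [:: l0]).
    apply: (forbidden Lw) => //; rewrite def_w.
    by rewrite -[_ ++ _]/([:: l0] ++ [:: l0; l0; c] ++ _) infix_infix.
  rewrite def_w def_g.
  by elim/letter_ind: c c_neq0 {def_w}.
have : infix (nseq 4 l0) (iter 3 phi [:: l0]).
  apply: (forbidden Lw) => //; rewrite def_w.
  by rewrite -[_ ++ _]/(nseq 4 l0 ++ _) prefix_infix.
by [].
Qed.

(** * Classification of the words of the language *)

(** A way for the extension graph to be connected that children inherit: the
    maps that carry right extensions of [y] to those of its children fix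
    [l0]. *)
Definition zero_dominated (w : word) : Prop :=
  forall a b, edge w a b -> edge w a l0.

(** Strictly more than [count_mem c p <= count_mem c u]: the surplus [l0] makes
    the relation stable in [ample_phi]. *)
Definition ample (u p : word) : Prop :=
  forall c, count_mem c (l0 :: p) <= count_mem c u.

(** A path [x p -- v -- u -- v' -- x' p] around a suffix [t] of [w = p ++ t].
    The words [u], [v] and [v'] are to be cut to [(size p).+1] letters, so they
    must not be shorter. An inequality between lengths need not survive [phi],
    whereas inequalities between the numbers of occurrences of each letter do;
    this is why [ample] is used here. *)
Variant detour (w : word) (x x' : letter) : Prop :=
  Detour p t u v v' of w = p ++ t & ample u p & ample v p & ample v' p &
    L (x :: w ++ v) & L (u ++ t ++ v) & L (u ++ t ++ v') & L (x' :: w ++ v').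

(** Besides the shape of the graph, two disjoint edges, this records what lets
    the shape persist in a child: one of the left extensions is [l1], so that
    its block ends with [l2] and the block of the other one with [l1]. *)
Variant split_word (w : word) (r : letter) : Prop :=
  SplitWord x x' of
    (forall a b, edge w a b <-> a = x /\ b = r \/ a = x' /\ b = l0) &
    x != x' & l1 \in [:: x; x'] & r != l0 & detour w x x'.

Variant word_class (w : word) : Prop :=
  | LeftUnique of left_unique w
  | RightUnique of right_unique w
  | ZeroDominated of zero_dominated w
  | DoubleZero of w = [:: l0; l0]
  | Split r of split_word w r.

Lemma left_stepE a c : left_step [::] a c = (c == last l0 (phi [:: a])).
Proof. by elim/letter_ind: a; elim/letter_ind: c. Qed.

Lemma cat_suffix_inj (T : eqType) (p q : seq T) (a b : T) (s : seq T) :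
  p ++ a :: s = q ++ b :: s -> a = b.
Proof.
move=> e; have sz : size p = size q.
  by move/(congr1 size): e; rewrite !size_cat => /addIn.
by move/eqP: e; rewrite eqseq_cat // => /andP[_ /eqP[]].
Qed.

Lemma left_step_inj s a c c' : left_step s a c -> left_step s a c' -> c = c'.
Proof.
by move=> /suffixP[q def_a] /suffixP[q']; rewrite def_a => /cat_suffix_inj.
Qed.

Lemma right_step_inj k b e e' : right_step k b e -> right_step k b e' -> e = e'.
Proof.
move=> /prefixP[q def_b] /prefixP[q' /eqP].
by rewrite def_b eqseq_cat ?size_rcons // => /andP[/eqP/rcons_inj[]].
Qed.

Lemma left_unique_child s y k : synchronized s y -> 0 < k <= 2 ->
  left_unique y -> left_unique (child s k y).
Proof.
move=> sync_sy k12 [a0 a0P].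
exists (nth l0 [seq c <- [:: l0; l1; l2] | left_step s a0 c] 0) => c e.
case/(edge_child _ _ sync_sy k12) => a [b [/a0P-> sa _]].
set cs := filter _ _; have : nth l0 cs 0 \in cs.
  apply: mem_nth; rewrite lt0n size_eq0; apply/eqP => cs0.
  have : c \in cs by rewrite mem_filter sa; elim/letter_ind: c {sa}.
  by rewrite cs0.
by rewrite mem_filter => /andP[+ _]; apply: left_step_inj.
Qed.

Lemma right_unique_child s y k : synchronized s y -> 0 < k <= 2 ->
  right_unique y -> right_unique (child s k y).
Proof.
move=> sync_sy k12 [b0 b0P].
exists (nth l0 [seq e <- [:: l0; l1; l2] | right_step k b0 e] 0) => c e.
case/(edge_child _ _ sync_sy k12) => a [b [/b0P-> _ rb]].
set cs := filter _ _; have : nth l0 cs 0 \in cs.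
  apply: mem_nth; rewrite lt0n size_eq0; apply/eqP => cs0.
  have : e \in cs by rewrite mem_filter rb; elim/letter_ind: e {rb}.
  by rewrite cs0.
by rewrite mem_filter => /andP[+ _]; apply: right_step_inj.
Qed.

Lemma right_step0 k : 0 < k <= 2 -> right_step k l0 l0.
Proof. by case: k => [|[|[|]]]. Qed.

Lemma zero_dominated_child s y k : synchronized s y -> 0 < k <= 2 ->
  zero_dominated y -> zero_dominated (child s k y).
Proof.
move=> sync_sy k12 dom_y c e.
case/(edge_child _ _ sync_sy k12) => a [b [/dom_y Lya0 sa _]].
apply/(edge_child _ _ sync_sy k12); exists a, l0; split=> //.
exact: right_step0.
Qed.

(** * Disconnected words *)

Lemma count_phi x : (count_mem l0 (phi x) =
    3 * count_mem l0 x + count_mem l1 x + 2 * count_mem l2 x) *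
  (count_mem l1 (phi x) = count_mem l0 x + count_mem l2 x) *
  (count_mem l2 (phi x) = count_mem l1 x).
Proof.
elim: x => // a x [[IH0 IH1] IH2].
rewrite phi_cons !count_cat IH0 IH1 IH2 /=.
move: (count_mem l0 x) (count_mem l1 x) (count_mem l2 x) => n0 n1 n2.
by elim/letter_ind: a => /=; split; [split| | split| | split|]; lia.
Qed.

Lemma size_count (x : word) :
  size x = count_mem l0 x + count_mem l1 x + count_mem l2 x.
Proof.
elim: x => // a x /= ->.
move: (count_mem l0 x) (count_mem l1 x) (count_mem l2 x) => n0 n1 n2.
by elim/letter_ind: a => /=; lia.
Qed.

Lemma ample_size u p : ample u p -> size p < size u.
Proof.
move=> up; move: (up l0) (up l1) (up l2); rewrite !size_count /=.
move: (count_mem l0 u) (count_mem l1 u) (count_mem l2 u) => u0 u1 u2.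
move: (count_mem l0 p) (count_mem l1 p) (count_mem l2 p) => p0 p1 p2.
lia.
Qed.

(** The additional [l0] required by [ample] contributes three zeros to the
    image, and at least one of them is left after the removal of [k <= 2]
    zeros. *)
Lemma ample_phi u v p k : ample u p -> k <= 2 -> phi u = nseq k l0 ++ v ->
  ample v (phi p).
Proof.
move=> up k2 def_u c; move: (up l0) (up l1) (up l2).
have := congr1 (count_mem l0) def_u.
have := congr1 (count_mem l1) def_u.
have := congr1 (count_mem l2) def_u.
elim/letter_ind: c; rewrite !count_cat !count_nseq /= !count_phi;
  move: (count_mem l0 u) (count_mem l1 u) (count_mem l2 u) => u0 u1 u2;
  move: (count_mem l0 p) (count_mem l1 p) (count_mem l2 p) => p0 p1 p2;
  move: (count_mem l0 v) (count_mem l1 v) (count_mem l2 v) => v0 v1 v2; lia.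
Qed.

Lemma right_step_phi k b e v : right_step k b e ->
  exists v1, phi (b :: v) = nseq k l0 ++ v1.
Proof.
case/prefixP=> q def_b; exists (e :: q ++ phi v).
by rewrite phi_cons def_b -cats1 -!catA.
Qed.

Lemma language_child y k a b v v1 : L (a :: y ++ b :: v) ->
  phi (b :: v) = nseq k l0 ++ v1 ->
  L (last l0 (phi [:: a]) :: child [::] k y ++ v1).
Proof.
move=> /language_phi + def_v; rewrite phi_cons phi_cat def_v.
have [q ->] : exists q, phi [:: a] = rcons q (last l0 (phi [:: a])).
  elim/letter_ind: a; [by exists (nseq 3 l0) | by exists (nseq 1 l0) |
    by exists (nseq 2 l0)].
rewrite last_rcons cat_rcons /child cat0s -catA => /language_factor; apply.
by apply: suffixW; apply: suffix_suffix.
Qed.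

(** The right extensions [r] and [l0] stay distinct when exactly as many zeros
    as the index of [r] are appended: [phi [:: l1]] and [phi [:: l0]] differ
    after one zero, [phi [:: l2]] and [phi [:: l0]] after two. *)
Lemma split_word_step w r : split_word w r -> synchronized [::] w ->
  exists r', split_word (child [::] r w) r'.
Proof.
case=> x x' wE x_neq mem1 r_neq0 [p t u v v' def_w up vp v'p Lxv Luv Luv' Lxv'].
move=> sync_w; have r12 : 0 < r <= 2 by elim/letter_ind: r r_neq0 {wE}.
have [r' r'_neq0 stepr] : exists2 r', r' != l0 & right_step r r r'.
  by elim/letter_ind: r r_neq0 {wE r12}; [|exists l2|exists l1].
have step0 := right_step0 r12.
exists r', (last l0 (phi [:: x])) (last l0 (phi [:: x'])) => //.
- move=> c e; rewrite edge_child //; split.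
    case=> a [b [/wE[][-> ->]]]; rewrite left_stepE => /eqP->.
      by move/(right_step_inj stepr) <-; left.
    by move/(right_step_inj step0) <-; right.
  case=> -[-> ->]; [exists x, r | exists x', l0]; split=> //;
    by [rewrite left_stepE eqxx | rewrite wE; auto].
- by move: x_neq mem1 {wE Lxv Lxv'}; elim/letter_ind: x; elim/letter_ind: x'.
- by move: x_neq mem1 {wE Lxv Lxv'}; elim/letter_ind: x; elim/letter_ind: x'.
case: v => [|b v] in vp Lxv Luv; first by have := ample_size vp.
case: v' => [|b' v'] in v'p Lxv' Luv'; first by have := ample_size v'p.
have edge_head a c z : L (a :: w ++ c :: z) -> edge w a c.
  move/language_factor; apply.
  by rewrite -[c :: z]cat1s catA -cat_cons prefix_infix.
have def_b : b = r.
  have /wE[[]//|[/eqP]] := edge_head _ _ _ Lxv; by rewrite (negPf x_neq).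
have def_b' : b' = l0.
  have /wE[[/eqP]|[]//] := edge_head _ _ _ Lxv'.
  by rewrite eq_sym (negPf x_neq).
rewrite {}def_b {}def_b' in vp Lxv Luv v'p Lxv' Luv'.
have [v1 def_v1] := right_step_phi v stepr.
have [v1' def_v1'] := right_step_phi v' step0.
have r2 : r <= 2 by case/andP: r12.
exists (phi p) (phi t ++ nseq r l0) (phi u) v1 v1'.
- by rewrite /child def_w phi_cat cat0s -catA.
- exact: (@ample_phi _ (phi u) _ 0 up).
- exact: ample_phi vp r2 def_v1.
- exact: ample_phi v'p r2 def_v1'.
- exact: language_child Lxv def_v1.
- by have := language_phi Luv; rewrite !phi_cat def_v1 -catA.
- by have := language_phi Luv'; rewrite !phi_cat def_v1' -catA.
exact: language_child Lxv' def_v1'.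
Qed.

Definition first_split_word : word := child [:: l0; l0; l1] 1 [:: l0; l0].

Lemma split_word_first : split_word first_split_word l2.
Proof.
exists l0 l1 => //.
  move=> c e; rewrite edge_child //; last exact: SyncSuffix.
  split=> [[a [b []]]|].
    rewrite edge_short //.
    by elim/letter_ind: a; elim/letter_ind: b => //;
       elim/letter_ind: c => //; elim/letter_ind: e; vm_compute; auto.
  by case=> -[-> ->]; [exists l0, l1 | exists l2, l0]; split=> //;
    apply/edge_short.
(* Here [p] is [001] and [t] is [phi(00) 0]. *)
exists [:: l0; l0; l1] [:: l0; l0; l0; l1; l0; l0; l0; l1; l0]
  [:: l0; l0; l1; l0; l2] [:: l2; l0; l0; l0; l1] [:: l0; l0; l1; l0; l2] => //.
- by move=> c; elim/letter_ind: c.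
- by move=> c; elim/letter_ind: c.
- by move=> c; elim/letter_ind: c.
- by apply: (@language_iter _ 5); vm_compute.
- by apply: (@language_iter _ 5); vm_compute.
- by apply: (@language_iter _ 5); vm_compute.
- by apply: (@language_iter _ 5); vm_compute.
Qed.

(** The first three classes are inherited by children. Of the children of [00],
    the one with [s = 001] and [k = 1] is [first_split_word], and the others are
    in the first three classes. A split word passes to the child of
    [split_word_step]; its other children have only one left extension, if
    [s = 001], or only one right extension. *)
Lemma classification w : L w -> word_class w.
Proof.
have [n] := ubnP (size w); elim: n w => // n IHn w w_lt Lw.
case: (bispecial_shape Lw) => [||w_short|[s [y [k [sync_sy k12 def_w]]]]].
- exact: LeftUnique.
- exact: RightUnique.
- have dom : w != [:: l0; l0] -> zero_dominated w.
    move=> w_neq a b; have w2 : size w <= 2.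
      by move: w_short; rewrite !inE => /or3P[] /eqP->.
    rewrite !edge_short //.
    move: w_short w_neq; rewrite !inE => /or3P[] /eqP-> //;
      by elim/letter_ind: a; elim/letter_ind: b; vm_compute.
  by have [/DoubleZero|/dom/ZeroDominated] := eqVneq w [:: l0; l0].
have Ly : L y.
  have [c [e]] := edge_ex Lw; rewrite def_w.
  by case/(edge_child _ _ sync_sy k12) => a [b [/edge_mid]].
have y_lt : size y < n.
  rewrite -ltnS; apply: leq_trans w_lt; rewrite ltnS def_w !size_cat size_nseq.
  apply: leq_ltn_trans (size_phi y) _; case/andP: k12 => k_gt0 _.
  by rewrite addnCA -[X in X < _]addn0 ltn_add2l ltn_addl.
case: (IHn y y_lt Ly) => [lu|ru|dom|def_y|r split_y].
- by apply: LeftUnique; rewrite def_w; apply: left_unique_child.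
- by apply: RightUnique; rewrite def_w; apply: right_unique_child.
- by apply: ZeroDominated; rewrite def_w; apply: zero_dominated_child.
- have yE a b : edge y a b <-> (a, b) \in
      [:: (l0, l1); (l1, l0); (l1, l1); (l2, l0)].
    rewrite def_y edge_short //.
    by elim/letter_ind: a; elim/letter_ind: b; vm_compute.
  have [k1|k2] : k = 1 \/ k = 2 by lia.
    rewrite {}k1 in def_w k12.
    case: sync_sy => [z|z] in def_w def_y yE Ly y_lt *; last first.
      apply: (@Split _ l2); rewrite def_w def_y; exact: split_word_first.
    apply: ZeroDominated; rewrite def_w => c e.
    case/(edge_child _ _ (SyncEmpty z) k12) => a [b [_ ac _]].
    apply/(edge_child _ _ (SyncEmpty z) k12).
    exists (if a == l1 then l1 else l2), l0; split=> //.
      by rewrite yE; case: (a == l1).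
    by elim/letter_ind: a ac; elim/letter_ind: c.
  apply: RightUnique; exists l0 => c e; rewrite def_w k2.
  case/(@edge_child _ _ 2 _ _ sync_sy isT) => a [b [/yE + _]].
  by elim/letter_ind: a; elim/letter_ind: b => //; elim/letter_ind: e.
have [x x' yE x_neq mem1 r_neq0 _] := split_y.
case: sync_sy => [z|z] in def_w yE Ly y_lt split_y *.
  have [k_r|k_r] := eqVneq k r.
    have [r' split_w] := split_word_step split_y (SyncEmpty z).
    by apply: (@Split _ r'); rewrite def_w k_r.
  apply: RightUnique; exists l0 => c e; rewrite def_w.
  case/(edge_child _ _ (SyncEmpty z) k12) => a [b [/yE + _]].
  case=> -[_ ->]; last by move/(right_step_inj (right_step0 k12)).
  have [k1|k2] : k = 1 \/ k = 2 by lia.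
    by elim/letter_ind: r r_neq0 k_r {split_y yE}; rewrite k1 //;
      elim/letter_ind: e.
  by elim/letter_ind: r r_neq0 k_r {split_y yE}; rewrite k2 //;
    elim/letter_ind: e.
apply: LeftUnique; exists (if l0 \in [:: x; x'] then l0 else l1) => c e.
rewrite def_w; case/(edge_child _ _ (SyncSuffix z) k12) => a [b [/yE Lab + _]].
have{Lab} : a \in [:: x; x'].
  by rewrite !inE; case: Lab => -[-> _]; rewrite eqxx ?orbT.
by move: x_neq mem1 {split_y yE}; elim/letter_ind: x; elim/letter_ind: x' => //;
  elim/letter_ind: a => //; elim/letter_ind: c.
Qed.

(** * Connectedness in extension graphs *)

Lemma ext_edgeP k l w u v : size u = k -> size v = l -> L (u ++ w ++ v) ->
  ext_edge L k l w (inl u) (inr v) /\ ext_edge L k l w (inr v) (inl u).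
Proof.
move=> su sv Luwv; suff e : ext_edge L k l w (inl u) (inr v) by [].
split=> //; split=> //; apply: language_factor Luwv _.
- exact: prefix_infix.
- by rewrite catA prefix_infix.
- by apply: suffixW; rewrite catA suffix_suffix.
- by apply: suffixW; rewrite suffix_suffix.
Qed.

Lemma ext_edge_trunc d t u v : d <= size u -> d <= size v -> L (u ++ t ++ v) ->
  let u' := drop (size u - d) u in let v' := take d v in
  ext_edge L d d t (inl u') (inr v') /\ ext_edge L d d t (inr v') (inl u').
Proof.
move=> du dv Lutv u' v'; apply: ext_edgeP.
- by rewrite size_drop subKn.
- by rewrite size_takel.
apply: language_factor Lutv _; apply/infixP.
exists (take (size u - d) u), (drop d v).
by rewrite /u' /v' -!catA cat_take_drop [RHS]catA cat_take_drop.
Qed.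

Lemma left_ext1P w u : left_ext L 1 w u ->
  exists a b, u = [:: a] /\ edge w a b.
Proof.
case=> _; case: u => [|a [|//]] // _ /edge_right[b Lawb].
by exists a, b.
Qed.

Lemma suffix_connected1 w x : vertex (ext_graph L 1 1 w) x ->
  (forall a b, edge w a b -> component (ext_graph L 1 1 w) x (inl [:: a])) ->
  suffix_connected_word L w.
Proof.
move=> vx wx; exists 1; split=> //=; exists x; split=> // u.
by case/left_ext1P=> a [b [-> /wx]]; rewrite take0.
Qed.

(** A right extension adjacent to all left extensions connects them, already
    with [d = 1]. *)
Lemma dominated_suffix_connected w b : L w ->
  (forall a b', edge w a b' -> edge w a b) -> suffix_connected_word L w.
Proof.
move=> Lw dom_b; have edge_b a b' : edge w a b' ->
    ext_edge L 1 1 w (inl [:: a]) (inr [:: b]) /\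
    ext_edge L 1 1 w (inr [:: b]) (inl [:: a]).
  by move/dom_b => Lawb; apply: ext_edgeP.
apply: (@suffix_connected1 _ (inr [:: b])) => /=.
  have [a [b' /edge_b[]]] := edge_ex Lw.
  by case.
move=> a b' /edge_b[[va _ _] e]; split=> //=.
exact: rt_step.
Qed.

(** Cut to [d = (size p).+1] letters, the detour is a path in the extension graph
    of [t] between the images of [x] and [x'] under the natural embedding. *)
Lemma detour_suffix_connected w x x' : detour w x x' ->
  (forall a b, edge w a b -> a \in [:: x; x']) -> suffix_connected_word L w.
Proof.
case=> p t u v v' -> up vp v'p Lxv Luv Luv' Lxv' wE.
exists (size p).+1; split; first by rewrite /= ltnS size_cat leq_addr.
have behead_p : iter (size p) behead (p ++ t) = t.
  by elim: p {wE up vp v'p Lxv Lxv'} => //= a p; rewrite -iterS iterSr.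
rewrite /= behead_p take_size_cat //; rewrite -!catA -!cat_cons in Lxv Lxv'.
have trunc := @ext_edge_trunc (size p).+1 t.
have {Lxv} := trunc (x :: p) v (leqnn _) (ample_size vp) Lxv.
have {Lxv'} := trunc (x' :: p) v' (leqnn _) (ample_size v'p) Lxv'.
have {Luv} := trunc u v (ample_size up) (ample_size vp) Luv.
have {Luv'} := trunc u v' (ample_size up) (ample_size v'p) Luv'.
rewrite /= subnn drop0; set d := (size p).+1.
set U := drop _ u; set V := take d v; set V' := take d v'.
move=> [UV' V'U] [UV VU] [X'V' V'X'] [XV VX].
exists (inl (x :: p)); split=> [|_ /left_ext1P[a [b [-> /wE]]]].
  by case: XV.
rewrite !inE => /orP[] /eqP-> /=; split.
- by case: XV.
- exact: rt_refl.
- by case: X'V'.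
apply: (rt_trans _ _ _ (inr V)); first exact: rt_step.
apply: (rt_trans _ _ _ (inl U)); first exact: rt_step.
by apply: (rt_trans _ _ _ (inr V')); apply: rt_step.
Qed.

(** No single right extension is adjacent to the three left extensions here: the
    path from the left extension [l0] to the right extension [l0] has to pass
    through the right extension [l1] and the left extension [l1]. *)
Lemma double_zero_suffix_connected : suffix_connected_word L [:: l0; l0].
Proof.
have adj a b : infix [:: a; l0; l0; b] (iter 3 phi [:: l0]) ->
    ext_edge L 1 1 [:: l0; l0] (inl [:: a]) (inr [:: b]) /\
    ext_edge L 1 1 [:: l0; l0] (inr [:: b]) (inl [:: a]).
  by move/language_iter=> Lw; apply: ext_edgeP.
have [[v0 _ _] e01] := adj l0 l1 isT; have [[v1 _ _] e10] := adj l1 l0 isT.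
have [[v2 w0 _] e20] := adj l2 l0 isT; have [e11 _] := adj l1 l1 isT.
apply: (@suffix_connected1 _ (inr [:: l0])) => // a _ _.
elim/letter_ind: a; split=> //=; try exact: rt_step.
apply: (rt_trans _ _ _ (inl [:: l1])); first exact: rt_step.
by apply: (rt_trans _ _ _ (inr [:: l1])); apply: rt_step.
Qed.

Lemma suffix_connected_language : suffix_connected L.
Proof.
move=> w Lw _; case: (classification Lw) => [[a0 a0P]|[b0 b0P]|dom|->|r].
- have [a [b Lawb]] := edge_ex Lw.
  apply: (@dominated_suffix_connected _ b) => // a' b' /a0P->.
  by rewrite -(a0P _ _ Lawb).
- by apply: (@dominated_suffix_connected _ b0) => // a b /[dup] /b0P->.
- exact: dominated_suffix_connected dom.
- exact: double_zero_suffix_connected.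
case=> x x' wE _ _ _ /detour_suffix_connected; apply=> a b.
by rewrite !inE => /wE[] [-> _]; rewrite eqxx ?orbT.
Qed.

(** The two vertices of the edge [x -- r] form a union of components. *)
Lemma split_word_disconnected w r : split_word w r -> disconnected L w.
Proof.
case=> x x' wE x_neq _ r_neq0 _.
have Lxr : edge w x r by apply/wE; left.
have Lx'0 : edge w x' l0 by apply/wE; right.
split; first exact: edge_mid Lxr.
have [[vx _ _] _] := @ext_edgeP 1 1 w [:: x] [:: r] erefl erefl Lxr.
have [[vx' _ _] _] := @ext_edgeP 1 1 w [:: x'] [:: l0] erefl erefl Lx'0.
move/(_ (inl [:: x]) (inl [:: x']) vx vx') => [_ /= path_xx'].
pose P z := z = inl [:: x] \/ z = inr [:: r] :> word + word.
have closed y z : ext_edge L 1 1 w y z -> P y -> P z.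
  move=> e_yz def_y; case: def_y e_yz => ->; case: z => //= z [].
    move=> _ [_ sz _]; case: z sz => [|b [|//]] // _ /wE[[_ ->]|[/eqP]].
      by right.
    by rewrite (negPf x_neq).
  move=> [_ sz _] _; case: z sz => [|a [|//]] // _ /wE[[-> _]|[_ /eqP]].
    by left.
  by rewrite (negPf r_neq0).
have [] : P (inl [:: x']); last by [].
  elim: path_xx' (or_introl erefl : P (inl [:: x])) => //.
  by move=> ? z ? _ IH1 _ IH2 /IH1/IH2.
by case=> x'_x; rewrite x'_x eqxx in x_neq.
Qed.

Lemma split_words_unbounded n :
  exists w r, [/\ split_word w r, synchronized [::] w & n <= size w].
Proof.
elim: n => [|n [w [r [split_w sync_w n_le]]]].
  exists first_split_word, l2; split=> //; first exact: split_word_first.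
  exact: SyncEmpty.
have [r' split_w'] := split_word_step split_w sync_w.
exists (child [::] r w), r'; split=> //; first by inversion sync_w; apply: SyncEmpty.
apply: leq_ltn_trans n_le _; apply: leq_ltn_trans (size_phi w) _.
rewrite /child cat0s size_cat size_nseq -[X in X < _]addn0 ltn_add2l.
case: split_w => x x' _ _ _ + _.
by elim/letter_ind: r {r' split_w'}.
Qed.

Theorem theorem1p4 :
  [/\ primitive phi,
      suffix_connected (language phi) &
      infinite_set [set w | disconnected (language phi) w]%classic].
Proof.
split; [exact: primitive_phi | exact: suffix_connected_language |].
move/finite_seqP => [s def_s].
have [w [r [split_w _ w_big]]] := split_words_unbounded (\max_(u <- s) size u).+1.
have : w \in s.
  suff : [set` s]%classic w by [].
  by rewrite -def_s; apply: split_word_disconnected split_w.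
by move=> w_s; move: w_big; rewrite ltnNge leq_bigmax_seq.
Qed.
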